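(* Let $\mathbb{F}$ be a field, let $n\ge 2$, and let $A=(a_{ij})$ be an $n\times n$ matrix over $\mathbb{F}$. For $1\le i,j\le n$ let $C_{ij}$ be $(-1)^{i+j}$ times the determinant of the $(n-1)\times(n-1)$ matrix obtained from $A$ by removing its $i$-th row and $j$-th column. Then for every $i\in\{1,\ldots,n\}$ (expansion along the $i$-th row) $$\det(A)=\sum_{j=1}^n a_{ij}C_{ij},$$ and for every $j\in\{1,\ldots,n\}$ (expansion along the $j$-th column) $$\det(A)=\sum_{i=1}^n a_{ij}C_{ij}.$$
   Context: Given a vector space $V$ over a field $\mathbb{F}$ and an integer $n\ge 1$, an $n$-determinant on $V$ is a function $D:V^n\to\mathbb{F}$ that is not identically zero, such that for all $v_1,\ldots,v_n,b\in V$ one has $$D(v_1,\ldots,v_n)\cdot b=\sum_{k=1}^n D(v_1,\ldots,v_{k-1},b,v_{k+1},\ldots,v_n)\cdot v_k,$$ and such that $V$ is not spanned by any $n-1$ vectors of $V$ (so that $V$ has dimension $n$ over $\mathbb{F}$). For every $n\ge 1$ the vector space $\mathbb{F}^n$ has a unique $n$-determinant, denoted $\det$, such that $\det(e_1,\ldots,e_n)=1$, where $e_1,\ldots,e_n$ is the standard basis. For an $n\times n$ matrix $A$ over $\mathbb{F}$ with rows $r_1,\ldots,r_n\in\mathbb{F}^n$, $\det(A)$ means $\det(r_1,\ldots,r_n)$. *)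

(* Defs.v *)
From mathcomp Require Import all_boot all_order all_algebra.
Set Implicit Arguments. Unset Strict Implicit. Unset Printing Implicit Defensive.
Import GRing.Theory.
Local Open Scope ring_scope.

(* [(V ^ n)%type] is [{ffun 'I_n -> V}], the type of n-tuples of elements of V *)

Definition subst_at (T : Type) (n : nat) (v : (T ^ n)%type) (k : 'I_n) (b : T) :
  (T ^ n)%type := [ffun i => if i == k then b else v i].

Definition spans (F : fieldType) (V : lmodType F) (m : nat) (w : (V ^ m)%type) : Prop :=
  forall b : V, exists c : 'I_m -> F, b = \sum_(i < m) c i *: w i.

(* To be used with 0 < n: n.-1 is then n - 1. *)
Definition is_ndeterminant (F : fieldType) (V : lmodType F) (n : nat)
    (D : (V ^ n)%type -> F) : Prop :=
  [/\ exists v, D v <> 0,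
      forall (v : (V ^ n)%type) (b : V),
        D v *: b = \sum_(k < n) D (subst_at v k b) *: v k
    & forall w : (V ^ n.-1)%type, ~ spans w].

Definition std_basis (F : fieldType) (n : nat) : ('rV[F]_n ^ n)%type :=
  [ffun i => delta_mx 0 i].

Definition is_std_det (F : fieldType) (n : nat) (D : ('rV[F]_n ^ n)%type -> F) : Prop :=
  is_ndeterminant D /\ D (std_basis F n) = 1.

Lemma std_det_exists (F : fieldType) (n : nat) :
  {D : ('rV[F]_n ^ n)%type -> F | (0 < n)%N -> is_std_det D}.
Proof.
exists (fun v => \det (\matrix_i v i)) => n_gt0.
have det1 : \det (\matrix_i std_basis F n i) = 1.
  rewrite -[RHS](det1 F n); congr (\det _); apply/row_matrixP => i.
  by rewrite rowK ffunE row1.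
split=> //; split.
- by exists (std_basis F n); rewrite det1; apply/eqP/oner_neq0.
- move=> v b; set A := \matrix_i v i.
  transitivity (b *m \adj A *m A).
    by rewrite -mulmxA mul_adj_mx mul_mx_scalar.
  rewrite mulmx_sum_row; apply: eq_bigr => k _; rewrite rowK; congr (_ *: _).
  rewrite (expand_det_row _ k) !mxE; apply: eq_bigr => j _.
  rewrite !mxE ffunE eqxx; congr (_ * _).
  rewrite /cofactor; congr (_ * \det _); apply/matrixP => p q.
  by rewrite !mxE ffunE eq_sym (negPf (neq_lift _ _)).
- move=> w sw.
  have : ((1%:M : 'M[F]_n) <= \matrix_i w i)%MS.
    apply/row_subP => i; have [c ->] := sw (row i 1%:M).
    apply: summx_sub => k _; apply: scalemx_sub.
    by rewrite -[w k](rowK w) row_sub.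
  move/mxrankS; rewrite mxrank1 => /leq_trans/(_ (rank_leq_row _)).
  by rewrite -ltnS prednK // ltnn.
Qed.

(* The value for n = 0 is irrelevant (and unspecified). *)
Definition std_det (F : fieldType) (n : nat) : ('rV[F]_n ^ n)%type -> F :=
  sval (std_det_exists F n).

Lemma std_detP (F : fieldType) (n : nat) : (0 < n)%N -> is_std_det (@std_det F n).
Proof. exact: (svalP (std_det_exists F n)). Qed.

Lemma ndet_eq0 (F : fieldType) (n : nat) (D : ('rV[F]_n ^ n)%type -> F)
    (v : ('rV[F]_n ^ n)%type) :
  is_ndeterminant D -> \matrix_i v i \notin unitmx -> D v = 0.
Proof.
move=> [_ HD _]; apply: contraNeq => Dv.
rewrite -row_full_unit -sub1mx; apply/row_subP => i.
rewrite -[row i _](scalerK Dv) HD; apply: scalemx_sub.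
by apply: summx_sub => k _; rewrite scalemx_sub // -[v k](rowK v) row_sub.
Qed.

Lemma ndet_subst (F : fieldType) (n : nat) (D : ('rV[F]_n ^ n)%type -> F)
    (v : ('rV[F]_n ^ n)%type) k b :
  is_ndeterminant D -> \matrix_i v i \in unitmx ->
  D (subst_at v k b) = D v * (b *m invmx (\matrix_i v i)) 0 k.
Proof.
move=> [_ HD _] uA; set A := \matrix_i v i in uA *.
have /(congr1 (fun u => (u *m invmx A) 0 k)) :
    D v *: b = (\row_j D (subst_at v j b)) *m A.
  rewrite HD mulmx_sum_row; apply: eq_bigr => j _.
  by rewrite rowK mxE.
by rewrite mulmxK // -scalemxAl !mxE => <-.
Qed.

Lemma std_det_unique (F : fieldType) (n : nat) (D1 D2 : ('rV[F]_n ^ n)%type -> F) :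
  is_std_det D1 -> is_std_det D2 -> D1 =1 D2.
Proof.
move=> [n1 e1] [n2 e2] v.
have [uv|nv] := boolP (\matrix_i v i \in unitmx); last by rewrite !ndet_eq0.
(* a single substitution with nonzero coordinate keeps a basis and, both D1 and
   D2 being multiplied by that coordinate, reflects D1 v = D2 v *)
have step (u : ('rV[F]_n ^ n)%type) k b : \matrix_i u i \in unitmx ->
    (b *m invmx (\matrix_i u i)) 0 k != 0 ->
    \matrix_i subst_at u k b i \in unitmx /\
    (D1 (subst_at u k b) = D2 (subst_at u k b) -> D1 u = D2 u).
  move=> uu nz; split; last by rewrite !ndet_subst // => /(mulIf nz).
  set B := \matrix_i _; rewrite -row_full_unit -sub1mx.
  have sB i : i != k -> (u i <= B)%MS.
    by move=> ik; have := row_sub i B; rewrite rowK ffunE (negPf ik).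
  have ub : (u k <= B)%MS.
    have bB : (b <= B)%MS by have := row_sub k B; rewrite rowK ffunE eqxx.
    have := mulmxKV uu b; rewrite mulmx_sum_row (bigD1 k) //= rowK.
    move/(canRL (addrK _))/(congr1 (fun x => ((b *m invmx (\matrix_i u i)) 0 k)^-1 *: x)).
    rewrite scalerK // => ->; apply: scalemx_sub; apply: addmx_sub => //.
    rewrite -scaleN1r; apply: scalemx_sub; apply: summx_sub => i ik.
    by rewrite rowK scalemx_sub // sB.
  rewrite sub1mx; have : (\matrix_i u i <= B)%MS.
    apply/row_subP => i; rewrite rowK; case: (eqVneq i k) => [->//|]; exact: sB.
  by move: uu; rewrite -row_full_unit -!sub1mx; apply: submx_trans.
suff main m (u : ('rV[F]_n ^ n)%type) : (m <= n)%N ->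
    (forall i : 'I_n, (i < n - m)%N -> u i = delta_mx 0 i) ->
    \matrix_i u i \in unitmx -> D1 u = D2 u.
  by apply: (main n) => // i; rewrite subnn.
elim: m u => [|m IHm] u le_mn ue uu.
  have -> : u = std_basis F n by apply/ffunP => i; rewrite ue ?subn0 // ffunE.
  by rewrite e1 e2.
have lt_i : (n - m.+1 < n)%N by rewrite ltn_subrL /= (leq_trans _ le_mn).
set i := Ordinal lt_i.
have nS : (n - m)%N = (n - m.+1).+1 by rewrite -subSn.
(* once the i-th coordinate of e_i is nonzero, put e_i at position i *)
have put (w : ('rV[F]_n ^ n)%type) :
    (forall j : 'I_n, (j < n - m.+1)%N -> w j = delta_mx 0 j) ->
    \matrix_j w j \in unitmx ->
    ((delta_mx 0 i : 'rV[F]_n) *m invmx (\matrix_j w j)) 0 i != 0 -> D1 w = D2 w.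
  move=> we uw nz; have [uw' ->//] := step _ _ _ uw nz.
  apply: IHm (ltnW le_mn) _ uw' => j; rewrite nS ltnS leq_eqVlt ffunE.
  case: (eqVneq j i) => [->//|ji] /orP[/eqP jE|/we//].
  by case/eqP: ji; apply: val_inj.
set c := (delta_mx 0 i : 'rV[F]_n) *m invmx (\matrix_j u j).
have [ci0|] := eqVneq (c 0 i) 0; last exact: put.
have /existsP[k /andP[le_ik ck]] : [exists k : 'I_n, (i <= k)%N && (c 0 k != 0)].
  apply: contraT; rewrite negb_exists => /forallP c0.
  have := mulmxKV uu (delta_mx 0 i : 'rV[F]_n); rewrite -/c mulmx_sum_row.
  move/(congr1 (fun x : 'rV_n => x 0 i)); rewrite summxE big1 => [|j _].
    by rewrite mxE !eqxx => /esym/eqP; rewrite oner_eq0.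
  rewrite mxE rowK; case: (leqP i j) => ij.
    by have := c0 j; rewrite ij /= negbK => /eqP->; rewrite mul0r.
  by rewrite ue // [X in _ * X]mxE eqxx /= -val_eqE (gtn_eqF ij) mulr0.
have ki : k != i by apply: contraNneq ck => ->; rewrite ci0.
have uinv j : u j *m invmx (\matrix_j u j) = delta_mx 0 j.
  by rewrite -[u j](rowK u) -row_mul mulmxV // row1.
have nz : ((u k - u i) *m invmx (\matrix_j u j)) 0 k != 0.
  by rewrite mulmxBl !uinv !mxE !eqxx (negPf ki) subr0 oner_neq0.
have [uw ->//] := step _ _ _ uu nz; apply: put => //.
  by move=> j ji; rewrite ffunE ifN ?ue // -val_eqE ltn_eqF // (leq_trans ji).
set w := subst_at u k (u k - u i) in uw *.
suff -> : (delta_mx 0 i : 'rV[F]_n) *m invmx (\matrix_j w j) = c + c 0 k *: delta_mx 0 i.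
  by rewrite mxE [X in _ + X]mxE ci0 add0r [X in _ * X]mxE !eqxx mulr1.
apply: (canLR (mulmxK uw)).
have wE j : w j = u j - (j == k)%:R *: u i.
  by rewrite ffunE; case: eqP => [->|_]; rewrite ?scale1r ?scale0r ?subr0.
rewrite -[LHS](mulmxKV uu) -/c mulmxDl -scalemxAl -rowE rowK.
rewrite wE eq_sym (negPf ki) scale0r subr0.
rewrite !mulmx_sum_row; under [X in _ = X + _]eq_bigr do rewrite rowK wE scalerBr.
rewrite big_split /= (bigD1 (P := predT) k (F := fun j => - _)) //= eqxx scale1r.
rewrite [X in - _ + X]big1 => [|j /negPf->]; last by rewrite scale0r scaler0 oppr0.
by rewrite addr0 addrNK; under eq_bigr do rewrite rowK.
Qed.

Definition mxdet (F : fieldType) (n : nat) (A : 'M[F]_n) : F :=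
  std_det [ffun i => row i A].

(* Indices start at 0 here, which does not change the parity of i + j. *)
Definition signed_minor (F : fieldType) (n : nat) (A : 'M[F]_n) (i j : 'I_n) : F :=
  (-1) ^+ (i + j) * mxdet (row' i (col' j A)).

(* Main.v *)
(* By uniqueness of the n-determinant normalized on the standard basis, [mxdet]
   is the Leibniz determinant [\det], whose Laplace expansions are known.  The
   defining identity of an n-determinant is Cramer's rule [adj A * A = det A]. *)
Require Import Defs.
From mathcomp Require Import all_boot all_order all_algebra.
Set Implicit Arguments. Unset Strict Implicit. Unset Printing Implicit Defensive.
Import GRing.Theory.
Local Open Scope ring_scope.

(** Expand along row [k]: its cofactors ignore row [k] itself, so they are those of the original
    matrix, i.e. column [k] of the adjugate. *)
Lemma det_subst_at (R : comNzRingType) (n : nat) (v : ('rV[R]_n ^ n)%type) k b :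
  \det (\matrix_i subst_at v k b i) = (b *m \adj (\matrix_i v i)) 0 k.
Proof.
rewrite (expand_det_row _ k) mxE; apply: eq_bigr => j _.
rewrite !mxE ffunE eqxx; congr (_ * (_ * \det _)).
by apply/matrixP => p q; rewrite !mxE ffunE eq_sym (negPf (neq_lift _ _)).
Qed.

Lemma is_std_det_det (F : fieldType) (n : nat) : (0 < n)%N ->
  is_std_det (fun v : ('rV[F]_n ^ n)%type => \det (\matrix_i v i)).
Proof.
(* The non-spanning clause does not mention the function, so it carries over from [std_det]. *)
move=> n_gt0; have [[_ _ span_n] _] := std_detP F n_gt0.
have det_std : \det (\matrix_i std_basis F n i) = 1.
  by rewrite -(det1 F n); congr (\det _); apply/row_matrixP => i; rewrite rowK ffunE row1.
split=> //; split=> // [|v b].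
  by exists (std_basis F n); rewrite det_std; apply/eqP/oner_neq0.
rewrite -mul_mx_scalar -mul_adj_mx mulmxA mulmx_sum_row.
by apply: eq_bigr => k _; rewrite det_subst_at rowK.
Qed.

Lemma mxdetE (F : fieldType) (n : nat) (A : 'M[F]_n) : (0 < n)%N -> mxdet A = \det A.
Proof.
move=> n_gt0; rewrite /mxdet (std_det_unique (std_detP F n_gt0) (is_std_det_det F n_gt0)).
by congr (\det _); apply/row_matrixP => i; rewrite rowK ffunE.
Qed.

Theorem corollary4p9 (F : fieldType) (n : nat) (n_ge2 : (2 <= n)%N) (A : 'M[F]_n) :
  (forall i : 'I_n, mxdet A = \sum_(j < n) A i j * signed_minor A i j) /\
  (forall j : 'I_n, mxdet A = \sum_(i < n) A i j * signed_minor A i j).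
Proof.
have minorE i j : signed_minor A i j = cofactor A i j.
  (* Since [2 <= n], minors have size [n.-1 > 0], where [std_det] is specified. *)
  by rewrite /signed_minor mxdetE // -ltnS prednK // ltnW.
rewrite mxdetE 1?ltnW //; split=> [i|j].
  by rewrite (expand_det_row _ i); apply: eq_bigr => j _; rewrite minorE.
by rewrite (expand_det_col _ j); apply: eq_bigr => i _; rewrite minorE.
Qed.
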